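(* Let $(M,g)$ be a complete Riemannian manifold, let $A\subseteq M$ be a totally convex set, let $\varphi:\mathbb{R}^2\to\mathbb{R}$ be sequentially upper bounded, and let $\{f_n\}_{n\in\mathbb{N}}$ be a non-empty family of geodesic $\varphi$-convex functions on $A$. If $\sup_n f_n(x)$ exists for each $x\in A$, then $f(x)=\sup_n f_n(x)$ is also a geodesic $\varphi$-convex function on $A$.
   Context: For $x,y\in M$, $\alpha_{xy}:[0,1]\to M$ denotes a geodesic arc with $\alpha_{xy}(0)=x$ and $\alpha_{xy}(1)=y$. A non-empty subset $A\subseteq M$ is totally convex if it contains every geodesic $\alpha_{xy}$ of $M$ whose end points $x,y$ belong to $A$. A function $f:A\to\mathbb{R}$ on a totally convex set $A$ is geodesic $\varphi$-convex if $f(\alpha_{xy}(t))\le f(x)+t\,\varphi(f(y),f(x))$ for all $x,y\in A$, every geodesic arc $\alpha_{xy}$ from $x$ to $y$, and all $t\in[0,1]$. A bifunction $\varphi:\mathbb{R}^2\to\mathbb{R}$ is sequentially upper bounded if $\sup_n\varphi(x_n,y_n)\le\varphi(\sup_n x_n,\sup_n y_n)$ for any two bounded real sequences $\{x_n\}$ and $\{y_n\}$. *)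

(* Defs.v *)
From HB Require Import structures.
From mathcomp Require Import all_boot all_order all_algebra.
From mathcomp Require Import all_classical all_reals all_analysis.
Set Implicit Arguments.
Unset Strict Implicit.
Unset Printing Implicit Defensive.
Import Order.TTheory GRing.Theory Num.Theory.
Import numFieldNormedType.Exports.
Local Open Scope classical_set_scope.
Local Open Scope ring_scope.

(* f is C^k on the open set U; only the values of f on U matter.  For V of
   finite dimension, the existence and continuity of all iterated directional
   derivatives up to order k is the usual C^k condition. *)
Fixpoint class_C (R : realType) (V : normedModType R) (k : nat)
    (U : set V) (f : V -> R) : Prop :=
  (forall x, U x -> {for x, continuous f}) /\
  if k is k'.+1 then
    forall v, (forall x, U x -> derivable f x v) /\ class_C k' U ('D_v f)
  else True.

Definition smooth_on (R : realType) (V : normedModType R)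
    (U : set V) (f : V -> R) : Prop :=
  forall k, class_C k U f.

(* chart_map and chart_inv are total; they are only meaningful on chart_dom
   and on its image, respectively. *)
Record chart (R : realType) (n : nat) (M : topologicalType) := Chart {
  chart_dom : set M ;
  chart_map : M -> 'rV[R]_n ;
  chart_inv : 'rV[R]_n -> M ;
  chart_dom_open : open chart_dom ;
  chart_cod_open : open (chart_map @` chart_dom) ;
  chart_mapK : forall x, chart_dom x -> chart_inv (chart_map x) = x ;
  chart_map_continuous : {within chart_dom, continuous chart_map} ;
  chart_inv_continuous :
    {within chart_map @` chart_dom, continuous chart_inv} }.

Definition transition (R : realType) (n : nat) (M : topologicalType)
    (c d : chart R n M) : 'rV[R]_n -> 'rV[R]_n :=
  chart_map d \o chart_inv c.

(* The atlas need not be maximal. *)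
Record smoothManifold (R : realType) (n : nat) := SmoothManifold {
  carrier :> topologicalType ;
  manifold_hausdorff : hausdorff_space carrier ;
  manifold_second_countable : @second_countable carrier ;
  atlas_index : Type ;
  atlas : atlas_index -> chart R n carrier ;
  atlas_cover : forall x : carrier, exists i, chart_dom (atlas i) x ;
  atlas_smooth : forall i j (k : 'I_n),
    smooth_on
      (chart_map (atlas i) @` (chart_dom (atlas i) `&` chart_dom (atlas j)))
      (fun v => transition (atlas i) (atlas j) v 0 k) }.

(* A Riemannian metric through its coordinate matrices (g_ab) in the charts of
   the atlas.  Since 'J acts on row vectors from the right, metric_change is
     g^i_ab = \sum_(c, d) D_a tau_c * g^j_cd(tau) * D_b tau_d
   for the transition map tau from chart i to chart j. *)
Record riemannianMetric (R : realType) (n : nat) (M : smoothManifold R n) :=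
  RiemannianMetric {
  metric :> atlas_index M -> 'rV[R]_n -> 'M[R]_n ;
  metric_smooth : forall i (a b : 'I_n),
    smooth_on (chart_map (atlas i) @` chart_dom (atlas i))
      (fun v => metric i v a b) ;
  metric_sym : forall i (x : M), chart_dom (atlas i) x ->
    (metric i (chart_map (atlas i) x))^T = metric i (chart_map (atlas i) x) ;
  metric_posdef : forall i (x : M) (w : 'rV[R]_n), chart_dom (atlas i) x ->
    w != 0 -> 0 < (w *m metric i (chart_map (atlas i) x) *m w^T) 0 0 ;
  metric_change : forall i j (x : M),
    chart_dom (atlas i) x -> chart_dom (atlas j) x ->
    let v := chart_map (atlas i) x in
    let dtau := 'J (transition (atlas i) (atlas j)) v in
    metric i v = dtau *m metric j (chart_map (atlas j) x) *m dtau^T }.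

Section Geodesics.
Variables (R : realType) (n : nat) (M : smoothManifold R n)
  (g : riemannianMetric M).

Definition partial_derivative (a : 'I_n) (f : 'rV[R]_n -> R)
    (v : 'rV[R]_n) : R :=
  'D_(delta_mx 0 a) f v.

(* Gamma^k_ab in the chart i, at the point of coordinates v *)
Definition christoffel (i : atlas_index M) (v : 'rV[R]_n) (k a b : 'I_n) : R :=
  2^-1 * \sum_(l < n) invmx (g i v) k l *
    (partial_derivative a (fun w => g i w b l) v
     + partial_derivative b (fun w => g i w a l) v
     - partial_derivative l (fun w => g i w a b) v).

Definition coordinate (i : atlas_index M) (gamma : R -> M) (k : 'I_n)
    (t : R) : R :=
  chart_map (atlas i) (gamma t) 0 k.

(* gamma is a geodesic on the open interval J: a smooth curve satisfying the
   geodesic equation in every chart of the atlas.  Constant curves qualify. *)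
Definition geodesic_on (J : set R) (gamma : R -> M) : Prop :=
  {within J, continuous gamma} /\
  forall i, let J' := J `&` gamma @^-1` chart_dom (atlas i) in
    (forall k, smooth_on J' (coordinate i gamma k)) /\
    (forall t k, J' t ->
      derive1 (derive1 (coordinate i gamma k)) t
      + \sum_(a < n) \sum_(b < n)
          christoffel i (chart_map (atlas i) (gamma t)) k a b
          * derive1 (coordinate i gamma a) t
          * derive1 (coordinate i gamma b) t = 0).

Definition complete_riemannian : Prop :=
  forall (a b : R) (gamma : R -> M), a < b -> geodesic_on `]a, b[ gamma ->
  exists2 delta : R -> M, geodesic_on setT delta &
    forall t, a < t < b -> delta t = gamma t.

(* Only the values of alpha on [0, 1] matter; being a geodesic on the closed
   interval means being one on an open interval containing it. *)
Definition geodesic_arc (x y : M) (alpha : R -> M) : Prop :=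
  [/\ exists2 e : R, 0 < e & geodesic_on `]- e, 1 + e[ alpha,
      alpha 0 = x & alpha 1 = y].

Definition totally_convex (A : set M) : Prop :=
  A !=set0 /\
  forall x y alpha, A x -> A y -> geodesic_arc x y alpha ->
    forall t, 0 <= t <= 1 -> A (alpha t).

(* f : A -> R is represented by a function on M; when A is totally convex the
   values of f outside A are irrelevant. *)
Definition geodesic_convex (phi : R -> R -> R) (A : set M) (f : M -> R) :
    Prop :=
  forall x y alpha, A x -> A y -> geodesic_arc x y alpha ->
    forall t, 0 <= t <= 1 ->
      f (alpha t) <= f x + t * phi (f y) (f x).

End Geodesics.

(* The supremum on the left is taken in the extended reals because it is not
   assumed to be finite a priori (on an unbounded set of reals, sup is 0). *)
Definition sequentially_upper_bounded (R : realType) (phi : R -> R -> R) :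
    Prop :=
  forall x y : nat -> R, bounded_fun x -> bounded_fun y ->
    (ereal_sup (range (fun m => (phi (x m) (y m))%:E))
       <= (phi (sup (range x)) (sup (range y)))%:E)%E.

(* Main.v *)
Require Import Defs.
From HB Require Import structures.
From mathcomp Require Import all_boot all_order all_algebra.
From mathcomp Require Import all_classical all_reals all_analysis.
Set Implicit Arguments.
Unset Strict Implicit.
Unset Printing Implicit Defensive.
Import Order.TTheory GRing.Theory Num.Theory.
Import numFieldNormedType.Exports.
Local Open Scope classical_set_scope.
Local Open Scope ring_scope.

(** Sequential upper boundedness is nothing but a monotonicity property in
    disguise: it forces phi to be nondecreasing in both arguments jointly.
    Indeed, if a <= a' and b <= b', the sequences a, a', a', ... and
    b, b', b', ... are bounded with suprema a' and b', and the first term of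
    the sequence of values of phi is phi a b.  Each inequality
    f_m (alpha t) <= f_m x + t phi (f_m y) (f_m x) therefore persists when f_m
    is replaced by the pointwise supremum on the right, since t >= 0, and then
    one takes the supremum over m on the left.

    Going through monotonicity, rather than applying the hypothesis to the
    sequences f_m y and f_m x themselves, matters because these sequences have
    a finite supremum but may be unbounded below. *)

Section StepSequence.
Variables (R : realType) (a b : R).

Definition step_seq (m : nat) : R := if m is 0%N then a else b.

Lemma bounded_step_seq : bounded_fun step_seq.
Proof.
exists (Num.max `|a| `|b|); split; first exact: num_real.
move=> u /ltW; rewrite ge_max => /andP[au bu].
by case=> [|m] _.
Qed.

Lemma sup_step_seq : a <= b -> sup (range step_seq) = b.
Proof.
move=> ab.
have ub_b : ubound (range step_seq) b by move=> _ [[|m] _ <-].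
apply/le_anti/andP; split.
  by apply: ge_sup => //; exists a, 0%N.
by apply: ub_le_sup; [exists b | exists 1%N].
Qed.

End StepSequence.

(** Testing the hypothesis on two-valued sequences is enough: the pair (a, b)
    is met at index 0, and the suprema a' and b' are attained from index 1. *)
Lemma sequentially_upper_bounded_homo (R : realType) (phi : R -> R -> R)
    (a a' b b' : R) :
  sequentially_upper_bounded phi -> a <= a' -> b <= b' ->
  phi a b <= phi a' b'.
Proof.
move=> phi_sub aa' bb'.
have := phi_sub _ _ (bounded_step_seq a a') (bounded_step_seq b b').
rewrite !sup_step_seq // -lee_fin; apply: le_trans.
by apply: ereal_sup_ubound; exists 0%N.
Qed.

Theorem proposition4p6 (R : realType) (n : nat) (M : smoothManifold R n)
    (g : riemannianMetric M) (A : set M) (phi : R -> R -> R)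
    (f : nat -> M -> R) :
  complete_riemannian g ->
  totally_convex g A ->
  sequentially_upper_bounded phi ->
  (forall m, geodesic_convex g phi A (f m)) ->
  (forall x, A x -> has_sup (range (fun m => f m x))) ->
  geodesic_convex g phi A (fun x => sup (range (fun m => f m x))).
Proof.
move=> _ [_ A_convex] phi_sub f_convex f_sup x y alpha Ax Ay alphaP t t01.
have f_le_sup z m : A z -> f m z <= sup (range (fun k => f k z)).
  by move=> /f_sup[_ ubz]; apply: ub_le_sup => //; exists m.
have [sup_nonempty _] := f_sup _ (A_convex _ _ _ Ax Ay alphaP _ t01).
apply: ge_sup => // _ [m _ <-].
apply: le_trans (f_convex m _ _ _ Ax Ay alphaP _ t01) _.
case/andP: t01 => t0 _; apply: lerD; first exact: f_le_sup.
by apply: ler_wpM2l => //; apply: sequentially_upper_bounded_homo => //;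
  apply: f_le_sup.
Qed.
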